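(* (a) $\mu(S_{n,k})$ is the largest root of the equation \[ x^{3}-x^{2}-(n-1)x+n-1-2k=0; \] (b) $\mu(S_{n,k})\leq\sqrt{n-1+k}$ for $n-1+k\geq 9$, and $\mu(S_{n,1})>\sqrt{n}$ for $4\leq n\leq 8$.
   Context: For a graph $G$, $\mu(G)$ denotes the spectral radius of its adjacency matrix. $S_{n,k}$ denotes the star of order $n$ with $k$ disjoint edges within its independent set (the set of its $n-1$ non-central vertices). That is, $S_{n,k}$ has vertices $1,\ldots,n$, vertex $1$ is adjacent to all the other vertices, and the only further edges are the $k$ pairwise disjoint edges $\{2,3\},\{4,5\},\ldots,\{2k,2k+1\}$ (so $0\leq 2k\leq n-1$).
   Formalization: Part (a) is stated for n ≥ 2: for n = 1, k = 0 the graph is a single vertex with spectral radius 0, while the equation x³ − x² = 0 has largest root 1, so the claim fails there. *)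

(* Defs.v *)
From HB Require Import structures.
From mathcomp Require Import all_boot all_order all_algebra.
From mathcomp Require Import classical_sets reals.
From mathcomp Require Import complex.

Set Implicit Arguments.
Unset Strict Implicit.
Unset Printing Implicit Defensive.

Import Order.TTheory GRing.Theory Num.Theory.

Local Open Scope classical_set_scope.
Local Open Scope ring_scope.

(* The eigenvalues are the complex ones. *)
Definition spectral_radius (R : realType) (n : nat) (A : 'M[R]_n) : R :=
  sup [set ComplexField.Normc.normc z | z in
        [set z : R[i] | eigenvalue (map_mx (real_complex R) A) z]].

(* A simple graph on n vertices is a symmetric irreflexive relation on 'I_n. *)
Definition adjmx (R : realType) (n : nat) (e : rel 'I_n) : 'M[R]_n :=
  \matrix_(i, j) (e i j)%:R.

Definition mu (R : realType) (n : nat) (e : rel 'I_n) : R :=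
  spectral_radius (adjmx R e).

(* The edges on the labels 1, 2, ..., each listed once with its smaller
   endpoint first: {1, b} for b > 1, and {2t, 2t+1} for 1 <= t <= k. *)
Definition star_edge (k a b : nat) : bool :=
  ((a == 1) && (1 < b))%N
  || has (fun t => (a == 2 * t) && (b == 2 * t + 1))%N (iota 1 k).

(* The element i of 'I_n is the vertex labelled i + 1. *)
Definition S_ (n k : nat) : rel 'I_n :=
  fun i j => star_edge k i.+1 j.+1 || star_edge k j.+1 i.+1.

Lemma S_sym (n k : nat) : symmetric (@S_ n k).
Proof. by move=> i j; rewrite /S_ orbC. Qed.

Lemma S_irr (n k : nat) : irreflexive (@S_ n k).
Proof.
move=> i; rewrite /S_ orbb /star_edge; apply/norP; split.
  by case: (nat_of_ord i).
apply/hasPn => t _; apply/negP => /andP[/eqP -> /eqP].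
by move/eqP; rewrite addn1 (ltn_eqF (ltnSn _)).
Qed.

Definition largest_root (R : realType) (f : R -> R) (r : R) : Prop :=
  f r = 0 /\ forall x : R, f x = 0 -> x <= r.

(* Main.v *)
(* A nonnegative symmetric matrix with a positive eigenvector [w] for [l] has
   spectral radius [l]: pair the entrywise moduli of any other eigenvector with
   [w].  For S_{n,k} the eigenvector equation with value [x] at the centre, [a]
   at the matched leaves and [1] at the other leaves reads
   [x * a = x + a] and [x ^ 2 = 2k a + (n - 1 - 2k)]; eliminating [a] gives
   [(x - 1) * (x ^ 2 - (n - 1)) = 2k], which is the cubic equation. *)
Require Import Defs.
From HB Require Import structures.
From mathcomp Require Import all_boot all_order all_algebra.
From mathcomp Require Import reals.
From mathcomp Require Import classical_sets complex zify ring lra.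

Set Implicit Arguments.
Unset Strict Implicit.
Unset Printing Implicit Defensive.

Import Order.TTheory GRing.Theory Num.Theory.

Local Open Scope ring_scope.

(** * Spectral radius from a positive eigenvector *)

Lemma normc_real (R : rcfType) (x : R) :
  ComplexField.Normc.normc (x%:C)%C = `|x|.
Proof. by rewrite /= expr0n /= addr0 sqrtr_sqr. Qed.

Lemma normc_sum (R : rcfType) (I : Type) (r : seq I) (F : I -> R[i]) :
  ComplexField.Normc.normc (\sum_(i <- r) F i)
  <= \sum_(i <- r) ComplexField.Normc.normc (F i).
Proof.
elim: r => [|i r IHr]; first by rewrite !big_nil ComplexField.Normc.normc0.
rewrite !big_cons; apply: le_trans (le_normcD _ _) _.
by rewrite lerD2l.
Qed.

Lemma normc_ge0 (R : rcfType) (z : R[i]) : 0 <= ComplexField.Normc.normc z.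
Proof. by case: z => a b; apply: sqrtr_ge0. Qed.

(** [eigenvalue] concerns row vectors [v], while [w] is a column. The triangle inequality bounds
    [|z| u_j] by [\sum_i u_i A_ij]; pairing this with [w] makes the right side [l] times
    [\sum_j u_j w_j], a positive factor that cancels. *)
Lemma eigenvalue_le_pos_eigenvector (R : realType) (n : nat) (A : 'M[R]_n)
    (w : 'cV[R]_n) (l : R) (z : R[i]) :
  (forall i j, 0 <= A i j) -> (forall i, 0 < w i 0) -> A *m w = l *: w ->
  eigenvalue (map_mx (real_complex R) A) z ->
  ComplexField.Normc.normc z <= l.
Proof.
move=> A_ge0 w_gt0 Aw /eigenvalueP[v vA v_neq0].
pose u i := ComplexField.Normc.normc (v 0 i).
have u_ge0 i : 0 <= u i by apply: normc_ge0.
have zu j : ComplexField.Normc.normc z * u j <= \sum_i u i * A i j.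
  rewrite -ComplexField.Normc.normcM.
  move/rowP/(_ j): vA; rewrite !mxE => <-.
  apply: le_trans (normc_sum _ _) _; apply: ler_sum => i _.
  by rewrite mxE ComplexField.Normc.normcM normc_real ger0_norm.
have uw_gt0 : 0 < \sum_j u j * w j 0.
  have [j vj] : exists j, v 0 j != 0 by apply/rV0Pn.
  rewrite (bigD1 j) //= ltr_pwDl //.
    rewrite mulr_gt0 // lt_def u_ge0 andbT.
    by apply: contra vj => /eqP/ComplexField.Normc.eq0_normc ->.
  by apply: sumr_ge0 => i _; rewrite mulr_ge0 // ltW.
rewrite -(ler_pM2r uw_gt0) mulr_sumr.
apply: (@le_trans _ _ (\sum_j (\sum_i u i * A i j) * w j 0)).
  by apply: ler_sum => j _; rewrite mulrA ler_wpM2r // ltW.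
under eq_bigr do rewrite mulr_suml.
rewrite exchange_big /= mulr_sumr ler_sum // => i _.
move/colP/(_ i): Aw; rewrite !mxE => Aw.
by rewrite mulrCA -Aw mulr_sumr; under eq_bigr do rewrite -mulrA.
Qed.

Lemma spectral_radius_pos_eigenvector (R : realType) (n : nat)
    (A : 'M[R]_n.+1) (w : 'cV[R]_n.+1) (l : R) :
  A^T = A -> (forall i j, 0 <= A i j) -> (forall i, 0 < w i 0) ->
  A *m w = l *: w -> spectral_radius A = l.
Proof.
move=> A_sym A_ge0 w_gt0 Aw; rewrite /spectral_radius; set E := (X in sup X).
have l_ge0 : 0 <= l.
  move/colP/(_ 0): (Aw); rewrite !mxE => /esym lw.
  rewrite -(pmulr_lge0 _ (w_gt0 0)) lw sumr_ge0 // => i _.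
  by rewrite mulr_ge0 // ltW.
have lE : E l.
  exists (l%:C)%C; last by rewrite normc_real ger0_norm.
  (* By symmetry of [A] the transpose of [w] is a row eigenvector, so the bound [l] is attained. *)
  apply/eigenvalueP; exists (map_mx (real_complex R) w^T).
    rewrite -map_mxM -{1}A_sym -trmx_mul Aw.
    by apply/matrixP => i j; rewrite !mxE rmorphM.
  apply/eqP => /rowP/(_ 0); rewrite !mxE => -[w0].
  by have := w_gt0 0; rewrite w0 ltxx.
have ubE : ubound E l.
  by move=> _ [z /= /(eigenvalue_le_pos_eigenvector A_ge0 w_gt0 Aw) ? <-].
apply/eqP; rewrite eq_le ge_sup //; last by exists l.
by rewrite ub_le_sup //; exists l.
Qed.

(** * Adjacency in the star with [k] extra edges, and its eigenvector *)

Lemma S_center (n k : nat) (j : 'I_n.+1) : S_ k ord0 j = (0 < j)%N.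
Proof.
rewrite /S_ /star_edge /=.
case: j => -[|j] ltj //=; rewrite orbb.
by apply/negbTE/hasPn => t; rewrite mem_iota; lia.
Qed.

(* Label [2t] is the index [2t - 1], so odd indices are matched upwards. *)
Lemma S_leaf (n k : nat) (i j : 'I_n.+1) : (0 < i)%N ->
  S_ k i j = (j == 0 :> nat)
    || ((i <= 2 * k)%N && (j == (if odd i then i.+1 else i.-1) :> nat)).
Proof.
case: i j => i lti [j ltj] /= i_gt0; rewrite /S_ /star_edge /=.
apply/idP/idP.
  move=> /orP[/orP[|/hasP[t]]|/orP[|/hasP[t]]]; rewrite ?mem_iota; try lia.
  - by move=> tk /andP[/eqP a /eqP b]; rewrite ifT; lia.
  - by move=> tk /andP[/eqP a /eqP b]; rewrite ifF; lia.
move=> /orP[/eqP ->|/andP[ik /eqP jE]]; first by apply/orP; right; lia.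
case: ifP jE => oi ->.
  apply/orP; left; apply/orP; right; apply/hasP; exists i.+1./2; last lia.
  by rewrite mem_iota; lia.
apply/orP; right; apply/orP; right; apply/hasP; exists i./2; last lia.
by rewrite mem_iota; lia.
Qed.

Lemma sum_step (R : pzRingType) (d m : nat) (a b : R) : (d <= m)%N ->
  \sum_(i < m) (if (i < d)%N then a else b) = a *+ d + b *+ (m - d).
Proof.
move=> /subnKC; move: (m - d)%N => e <-; rewrite big_split_ord /=.
congr (_ + _).
  by under eq_bigr do rewrite ltn_ord; rewrite sumr_const card_ord.
by under eq_bigr do rewrite ltnNge leq_addr /=; rewrite sumr_const card_ord.
Qed.

(** Index [i] carries label [i + 1], so the matched leaves are the indices from 1 to [2 * k]. *)
Definition S_weight (R : fieldType) (n k : nat) (x : R) : 'cV[R]_n.+1 :=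
  \col_i
    if i == 0 :> nat then x else if (i <= 2 * k)%N then x / (x - 1) else 1.

(** The equation for [x ^+ 2] is the row of the centre. The value [x = 1] is allowed only for
    [k = 0], where it does occur: the star on two vertices has it as spectral radius. *)
Lemma S_weight_eigenvector (R : realType) (n k : nat) (x : R) :
  (2 * k <= n)%N -> ((0 < k)%N -> x != 1) ->
  x ^+ 2 = (x / (x - 1)) *+ (2 * k) + 1 *+ (n - 2 * k) ->
  adjmx R (@S_ n.+1 k) *m S_weight n k x = x *: S_weight n k x.
Proof.
move=> le_kn x_neq1 xE.
apply/colP => i; rewrite !mxE; under eq_bigr do rewrite !mxE.
have [i0|i_neq0] := eqVneq i ord0.
  rewrite i0 /= big_ord_recl /= S_center /= mul0r add0r.
  under eq_bigr do rewrite mul1r.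
  by rewrite sum_step // -expr2.
have i_gt0 : (0 < i)%N by rewrite lt0n.
have -> : (i == 0 :> nat) = false by lia.
rewrite (bigD1 ord0) //= S_leaf //= mul1r.
have [le_ik|lt_ki] := leqP.
  have k_gt0 : (0 < k)%N by lia.
  have x1 : x - 1 != 0 by rewrite subr_eq0 x_neq1.
  (* The matching partner is a vertex: an odd [i <= 2 * k] satisfies [i + 1 <= 2 * k <= n] by
     parity. *)
  have ltp : ((if odd i then i.+1 else i.-1) < n.+1)%N.
    by case: ifP => oi; lia.
  rewrite (bigD1 (Ordinal ltp)) /=; last first.
    by apply/eqP => /(congr1 val) /=; case: ifP; lia.
  rewrite S_leaf //= le_ik eqxx orbT mul1r.
  rewrite ifF; last by case: ifP; lia.
  rewrite ifT; last by case: ifP; lia.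
  rewrite big1 ?addr0; first by field.
  move=> j /andP[j0 jp]; rewrite S_leaf // le_ik /=.
  by move: j0 jp; rewrite -!val_eqE /= => /negbTE -> /negbTE ->; rewrite mul0r.
rewrite big1 ?addr0 ?mulr1 // => j j0.
rewrite S_leaf // leqNgt lt_ki /= orbF.
by move: j0; rewrite -val_eqE /= => /negbTE ->; rewrite mul0r.
Qed.

(** For [k > 0], cancelling [x - 1] recovers the row of the centre from the cubic. For [k = 0] the
    cubic also has the root 1, so [x ^+ 2 = n] is asked separately. *)
Lemma mu_S_root (R : realType) (n k : nat) (x : R) :
  (2 * k <= n)%N -> 1 <= x -> ((0 < k)%N -> x != 1) -> n%:R <= x ^+ 2 ->
  (x - 1) * (x ^+ 2 - n%:R) = 2 * k%:R -> (k = 0%N -> x ^+ 2 = n%:R) ->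
  mu R (@S_ n.+1 k) = x.
Proof.
move=> le_kn x_ge1 x_neq1 x2_ge xE x0.
have x_gt1 : (0 < k)%N -> 1 < x by move=> /x_neq1; rewrite lt_def x_ge1 => ->.
apply: (@spectral_radius_pos_eigenvector _ _ _ (S_weight n k x)).
- by apply/matrixP => i j; rewrite !mxE S_sym.
- by move=> i j; rewrite mxE ler0n.
- move=> i; rewrite mxE; case: ifP => [_|i0]; first exact: lt_le_trans x_ge1.
  case: ifP => // ik; have /x_gt1 x1 : (0 < k)%N by lia.
  by rewrite divr_gt0 ?subr_gt0 // (lt_trans ltr01).
apply: S_weight_eigenvector => //.
have [k0|k_gt0] := posnP k.
  by rewrite k0 muln0 mulr0n add0r subn0 x0.
have x1 : x - 1 != 0 by rewrite subr_eq0 x_neq1.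
rewrite -[_ *+ (2 * k)]mulr_natr natrB // natrM.
apply: (mulfI x1); move: xE; move: (k%:R) (n%:R) => K N xE.
have -> : (x - 1) * x ^+ 2 = 2 * K + (x - 1) * N by rewrite -xE; ring.
by field.
Qed.

(** * Roots of the cubic in factored form *)

Definition S_poly (R : realType) (m c : R) : {poly R} :=
  ('X - 1) * ('X^2 - m%:P) - c%:P.

Lemma horner_S_poly (R : realType) (m c x : R) :
  (S_poly m c).[x] = (x - 1) * (x ^+ 2 - m) - c.
Proof. by rewrite /S_poly !hornerE. Qed.

Lemma exists_S_root (R : realType) (m c a : R) :
  0 <= m -> 0 <= c -> 1 <= a -> (a - 1) * (a ^+ 2 - m) <= c ->
  exists2 x, a <= x & (x - 1) * (x ^+ 2 - m) = c.
Proof.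
(* This [b] gives [b - 1 >= c] and [b ^+ 2 - m >= 1], so the intermediate value theorem applies
   between [a] and [b]. *)
move=> m_ge0 c_ge0 a_ge1 a_le; pose b := a + m + c + 1.
have ab : a <= b by rewrite /b; lra.
have b_ge : c <= (b - 1) * (b ^+ 2 - m).
  by rewrite -[leLHS]mulr1 ler_pM //; rewrite /b; nra.
have [|x /andP[ax _]] := @Num.Theory.poly_ivt _ (S_poly m c) a b ab.
  by rewrite !horner_S_poly subr_le0 subr_ge0 a_le.
by rewrite rootE horner_S_poly subr_eq0 => /eqP; exists x.
Qed.

Lemma S_cubicE (R : realType) (n k : nat) (x : R) :
  x ^+ 3 - x ^+ 2 - (n.+1%:R - 1) * x + n.+1%:R - 1 - 2 * k%:R
  = (x - 1) * (x ^+ 2 - n%:R) - 2 * k%:R.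
Proof. by rewrite -natr1; ring. Qed.

(* For [1 <= x] and [m <= x ^ 2] both factors are nonnegative and increasing. *)
Lemma S_cubic_lt (R : realType) (m x y : R) :
  1 <= x -> m <= x ^+ 2 -> x < y ->
  (x - 1) * (x ^+ 2 - m) < (y - 1) * (y ^+ 2 - m).
Proof.
move=> x_ge1 m_le xy.
by rewrite ltr_pM ?subr_ge0 ?ltrD2r // ltr_sqr ?nnegrE; lra.
Qed.

(** At [s], the square root of the number of leaves, the product vanishes, so some root [x] of the
    cubic is at least [s]. It equals [mu] by the eigenvector, and strict growth beyond [s] excludes
    larger roots. *)
Lemma mu_S_largest_root (R : realType) (n k : nat) :
  (2 <= n)%N -> (2 * k <= n - 1)%N ->
  largest_root
    (fun x : R => x ^+ 3 - x ^+ 2 - (n%:R - 1) * x + n%:R - 1 - 2 * k%:R)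
    (mu R (@S_ n k)).
Proof.
case: n => // n n_gt0; rewrite subn1 /= => le_kn.
have n_ge1 : 1 <= n%:R :> R by rewrite ler1n; lia.
have k_ge0 : 0 <= k%:R :> R by rewrite ler0n.
pose s : R := Num.sqrt n%:R.
have s_ge1 : 1 <= s by rewrite -[leLHS]sqrtr1 ler_wsqrtr.
have s2 : s ^+ 2 = n%:R by rewrite sqr_sqrtr.
have [x [sx xE x_neq1 x0]] : exists x : R, [/\ s <= x,
    (x - 1) * (x ^+ 2 - n%:R) = 2 * k%:R,
    (0 < k)%N -> x != 1 & k = 0%N -> x ^+ 2 = n%:R].
  have [->|k_gt0] := posnP k.
    by exists s; split => //; rewrite s2 subrr !mulr0.
  have [||||x sx xE] := @exists_S_root R n%:R (2 * k%:R) s; try lra.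
    by rewrite s2 subrr mulr0; lra.
  exists x; split => //; last by move=> k0; rewrite k0 in k_gt0.
  move=> _; apply: contraTneq k_gt0 => x1; move: xE.
  rewrite x1 subrr mul0r => /esym/eqP.
  by rewrite mulf_eq0 !pnatr_eq0 /= => /eqP ->.
have x_ge1 : 1 <= x by lra.
have x2 : n%:R <= x ^+ 2 by rewrite -s2 ler_sqr // nnegrE; lra.
rewrite (@mu_S_root R n k x) //; split=> [|y].
  by rewrite S_cubicE xE subrr.
rewrite S_cubicE => /eqP; rewrite subr_eq0 => /eqP yE.
rewrite leNgt; apply/negP => /(S_cubic_lt x_ge1 x2).
by rewrite xE yE ltxx.
Qed.

Theorem lemma6 (R : realType) :
  (forall n k : nat, (2 <= n)%N -> (2 * k <= n - 1)%N ->
     largest_root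
       (fun x : R => x ^+ 3 - x ^+ 2 - (n%:R - 1) * x + n%:R - 1 - 2 * k%:R)
       (mu R (@S_ n k)))
  /\
  ((forall n k : nat, (2 * k <= n - 1)%N -> (9 <= n - 1 + k)%N ->
      mu R (@S_ n k) <= Num.sqrt (n - 1 + k)%:R)
   /\
   (forall n : nat, (4 <= n <= 8)%N ->
      Num.sqrt n%:R < mu R (@S_ n 1))).
Proof.
split; first exact: mu_S_largest_root.
split=> [n k le_kn le9|n /andP[n4 n8]].
  have n2 : (2 <= n)%N by lia.
  have [root_mu _] := @mu_S_largest_root R n k n2 le_kn.
  case: n n2 le_kn le9 root_mu => // n _; rewrite subn1 /= => le_kn le9.
  rewrite S_cubicE => /eqP; rewrite subr_eq0 => /eqP muE.
  set s := Num.sqrt _.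
  have s2 : s ^+ 2 = n%:R + k%:R by rewrite sqr_sqrtr // natrD.
  have s3 : 3 <= s.
    by rewrite -(@ler_sqr _ 3) ?nnegrE ?sqrtr_ge0 // s2 -natrD -natrX ler_nat.
  have k_ge0 : 0 <= k%:R :> R by rewrite ler0n.
  (* If [s] were below [mu], strict growth would make the cubic negative at [s]. *)
  rewrite leNgt; apply/negP => /(@S_cubic_lt _ n%:R).
  rewrite muE s2 => /(_ ltac:(lra) ltac:(lra)).
  (* At [s = sqrt (n - 1 + k)] the cubic is [k * (s - 3)]. *)
  by apply/negP; rewrite -leNgt; nra.
have n2 : (2 <= n)%N by lia.
have [_ mu_max] := @mu_S_largest_root R n 1 n2 ltac:(lia).
case: n n4 n8 {n2} mu_max => // n n4 n8 mu_max.
set s := Num.sqrt _.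
have s2 : s ^+ 2 = n%:R + 1 by rewrite sqr_sqrtr // -natr1.
have n3 : 3 <= n%:R :> R by rewrite ler_nat.
have s3 : s < 3.
  rewrite -(@ltr_sqr _ _ 3) ?nnegrE ?sqrtr_ge0 // s2 natr1 -natrX ltr_nat.
  by lia.
have s_ge1 : 1 <= s by rewrite -[leLHS]sqrtr1 ler_wsqrtr // ler1n.
(* At [s = sqrt n] the cubic is [s - 3 < 0]. *)
have [||||x sx xE] := @exists_S_root R n%:R (2 * 1%:R) s; try lra.
  by rewrite s2; nra.
have x_le : x <= mu R (@S_ n.+1 1).
  by apply: mu_max; rewrite S_cubicE xE subrr.
(* The inequality [s <= x] is strict because the cubic does not vanish at [s]. *)
apply: lt_le_trans x_le; rewrite lt_def sx andbT.
by apply/eqP => xs; move: xE; rewrite xs s2; lra.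
Qed.
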